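(* Let $(G,\omega)$ be a connected decorated planar graph of nilpotency degree zero; assume that $\omega$ is a characteristic weight and that $\Gamma^{\mathrm{inv}}_{(G,\omega)}$ is connected. Let $f_-$ and $f_+$ be respectively the minimum and the maximum of the distributive lattice $\mathcal{L}(G,\omega)$, and let $\xi_{\max}=(f_+,f_-,d_{\max})$ be the unique BMS state in $\mathrm{BMS}^+(G,\omega;f_-)$ mapping to $f_+$ under the forgetful map $(h_+,f_-,d)\mapsto h_+$. Then $\mathcal{L}(G,\omega)$ is isomorphic, as a lattice, to the lattice of subrepresentations of $\mathcal{M}(\xi_{\max})$.
   Context: **Planar graphs.** $G=(V_G,E_G)$ is a finite connected undirected multigraph (multiple edges allowed) without loops, with every vertex of degree $\ge 2$, embedded in the oriented sphere $S^2$; $F_G$ is its set of faces. An angle at a vertex $v$ is a pair of half-edges at $v$ that are consecutive in the clockwise cyclic order around $v$; it is oriented clockwise, from its source edge $s(a)$ to its target edge $t(a)$ (the next edge clockwise), and lies in one face. $A_G$ is the set of angles; $A_G(v)$, $A_G(f)$ are those at a vertex $v$, resp. in a face $f$. The directed medial graph (a quiver without loops) $\mathcal{Q}G$ has vertex set $E_G$ and one arrow $s(a)\to t(a)$ for each $a\in A_G$; for $x\in V_G\sqcup F_G$ the arrows $A_G(x)$ form an oriented cycle $\mathcal{Q}G(x)$. **Weights.** A weight is a class $\omega\in H^1(|\mathcal{Q}G|;\mathbb{Z})$ admitting compatible functions, equivalently a function $\omega\colon V_G\sqcup F_G\to\mathbb{Z}_{\ge0}$ with $\sum_{v}\omega(v)=\sum_f\omega(f)$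 ($\omega(x)$ being the value of the class on $\mathcal{Q}G(x)$). It is characteristic if this function takes values in $\{0,1\}$. An angular function $g\colon A_G\to\mathbb{Z}_{\ge0}$ is $\omega$-compatible if it represents $\omega$ as a cellular 1-cochain, equivalently $\sum_{a\in A_G(x)}g(a)=\omega(x)$ for all $x\in V_G\sqcup F_G$. $\mathcal{L}(G,\omega)$ is the set of these. For $\epsilon\colon E_G\to\mathbb{Z}$ let $(\delta\epsilon)(a)=\epsilon(t(a))-\epsilon(s(a))$; $\chi_e$ is the characteristic function of $e\in E_G$; $g\in\mathcal{L}(G,\omega)$ is $e$-movable if $g+\delta\chi_e\ge0$. $\mathcal{L}(G,\omega)$ is a directed graph with an edge $g\to g+\delta\chi_e$ for each $e$ such that $g$ is $e$-movable, and is ordered by: $g\le g'$ iff there is a directed path from $g$ to $g'$. **Invisible cycles.** An angular cycle is a cellular 1-cycle $c=\sum_a c_a a$ of $|\mathcal{Q}G|$ with all $c_a\ge0$; $\lambda_\omega(c)$ is the value of $\omega$ on it. $(G,\omega)$ has nilpotency degree zero if $\min\{\lambda_\omega(c):c\neq0\text{ an angular cycle}\}=0$. An angular cycle is invisible if $c\neq0$ and $\lambda_\omega(c)=0$, and connected if the arrows with $c_a\ne0$ form a connected subgraph. $\Gamma^{\mathrm{inv}}_{(G,\omega)}$ is the graph whose vertices are the connected invisible angular cycles, two being joined by an edge precisely when they share a vertex of $\mathcal{Q}G$. (Under the hypotheses of the claim, $\mathcal{L}(G,\omega)$ is a finite distributive lattice and the forgetful map below is a lattice isomorphism $\mathrm{BMS}^+(G,\omega;f_-)\to\mathcal{L}(G,\omega)$.)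 **BMS states.** A BMS state for $(G,\omega)$ is a triple $(f_+,f_-,d)$ with $f_\pm\in\mathcal{L}(G,\omega)$ and $d\colon E_G\to\mathbb{Z}_{\ge0}$ such that $f_+=f_-+\delta d$, and $d(e)=0$ for every edge $e$ belonging to a connected invisible angular cycle. $\mathrm{BMS}^+(G,\omega;g)$ is the directed graph whose vertices are the BMS states with $f_-=g$, with an edge from $(f_+,g,d)$ to $(f_++\delta\chi_e,g,d+\chi_e)$ for each $e\in E_G$ such that $f_+$ is $e$-movable. **The representation $\mathcal{M}(\xi)$** of the quiver $\mathcal{Q}G$ over $\mathbb{C}$, for a BMS state $\xi=(f_+,f_-,d)$: $\mathcal{M}(\xi)_e=\mathbb{C}^{d(e)}$ for $e\in E_G$. For an arrow $a$: if $f_-(a)\le d(s(a))$ and $f_+(a)\le d(t(a))$, put $r=d(s(a))-f_-(a)=d(t(a))-f_+(a)\ge0$ and let $\mathcal{M}(\xi)_a\colon\mathbb{C}^{d(s(a))}\to\mathbb{C}^{d(t(a))}$ be the matrix $\begin{pmatrix}0_{r\times f_-(a)}&\mathbb{1}_r\\0_{f_+(a)\times f_-(a)}&0_{f_+(a)\times r}\end{pmatrix}$; otherwise $\mathcal{M}(\xi)_a=0$. Subrepresentations are ordered by inclusion. *)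

(* Defs.v *)
From HB Require Import structures.
From mathcomp Require Import all_boot all_order all_algebra all_fingroup.
From mathcomp Require Import zify boolp.

Set Implicit Arguments.
Unset Strict Implicit.
Unset Printing Implicit Defensive.

Import GRing.Theory Num.Theory.
Local Open Scope ring_scope.
Local Open Scope quotient_scope.

(* A graph embedded in the oriented sphere, as a combinatorial map.  Darts are
   half-edges, [flip] exchanges the two halves of an edge, and [cw h] is the
   half-edge following [h] clockwise around their common vertex.

   The angle [(h, cw h)] is encoded by its source half-edge [h], so that
   darts and angles are in bijection.  If [a = (h, cw h)], the next angle
   clockwise around the vertex is [cw h], and the angle following [a] in its
   face is the one starting at the opposite half of the target edge of [a],
   i.e. [flip (cw h)].  Hence vertices, edges and faces are the cycles of [cw],
   [flip] and [cw * flip] (in MathComp, [(s * t) x = t (s x)]), and a vertex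
   or a face is literally the set of its angles. *)
Record planar_graph := PlanarGraph {
  dart : finType;
  flip : {perm dart};
  cw : {perm dart};
  face_next : {perm dart} := (cw * flip)%g;
  flipK : forall h, flip (flip h) = h;
  flip_neq : forall h, flip h != h;
  graph_connected :
    forall h k, connect [rel x y | (y == cw x) || (y == flip x)] h k;
  loopless : forall h, flip h \notin porbit cw h;
  degree_ge2 : forall h, (2 <= #|porbit cw h|)%N;
  sphere_euler :
    (#|porbits cw| + #|porbits face_next| = #|porbits flip| + 2)%N
}.

Definition angle (G : planar_graph) : finType := dart G.

Definition vertices (G : planar_graph) : {set {set angle G}} :=
  porbits (cw G).
Definition faces (G : planar_graph) : {set {set angle G}} :=
  porbits (face_next G).

Definition edge (G : planar_graph) : finType :=
  {e : {set dart G} | e \in porbits (flip G)}.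

Fact edge_of_subproof (G : planar_graph) (h : dart G) :
  porbit (flip G) h \in porbits (flip G).
Proof. exact: imset_f. Qed.

Definition edge_of (G : planar_graph) (h : dart G) : edge G :=
  exist (fun e => e \in porbits (flip G)) (porbit (flip G) h)
        (edge_of_subproof h).

(* Source and target of the arrows of the directed medial graph, whose
   vertices are the edges of [G] and whose arrows are the angles. *)
Definition src (G : planar_graph) (a : angle G) : edge G := edge_of a.
Definition tgt (G : planar_graph) (a : angle G) : edge G := edge_of (cw G a).

Notation cochain0 G := {ffun edge G -> int}.
Notation cochain1 G := {ffun angle G -> int}.

Definition delta (G : planar_graph) (eps : cochain0 G) : cochain1 G :=
  [ffun a => eps (tgt a) - eps (src a)].

Definition coboundary (G : planar_graph) : {pred cochain1 G} :=
  fun w => `[< exists eps : cochain0 G, w = delta eps >].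

Lemma coboundaryP (G : planar_graph) (w : cochain1 G) :
  reflect (exists eps : cochain0 G, w = delta eps) (w \in @coboundary G).
Proof. exact: asboolP. Qed.

Fact coboundary_zmod_closed (G : planar_graph) : zmod_closed (@coboundary G).
Proof.
split=> [|u v /coboundaryP[x ->] /coboundaryP[y ->]]; apply/coboundaryP.
  by exists 0; apply/ffunP=> a; rewrite !ffunE subrr.
exists (x - y); apply/ffunP=> a; rewrite !ffunE.
by rewrite !opprB addrACA [RHS]addrACA [in RHS](addrC (- y _)).
Qed.
HB.instance Definition _ (G : planar_graph) :=
  GRing.isZmodClosed.Build (cochain1 G) (@coboundary G)
    (coboundary_zmod_closed G).

(* First cohomology with integer coefficients of the 1-dimensional complex
   |QG|, on which every 1-cochain is a cocycle. *)
Definition H1 (G : planar_graph) := Quotient.quot (@coboundary G).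
HB.instance Definition _ (G : planar_graph) := Choice.on (H1 G).
HB.instance Definition _ (G : planar_graph) := GRing.Zmodule.on (H1 G).

Definition cohomology_class (G : planar_graph) (w : cochain1 G) : H1 G :=
  \pi_(Quotient.quot (@coboundary G)) w.

Definition compatible (G : planar_graph) (omega : H1 G)
    (g : {ffun angle G -> nat}) : bool :=
  cohomology_class [ffun a => (g a)%:Z] == omega.

Record weight (G : planar_graph) := Weight {
  weight_class :> H1 G;
  weight_compatible : exists g, compatible weight_class g
}.

Notation angular_chain G := {ffun angle G -> nat}.

Definition angular_cycle (G : planar_graph) (c : angular_chain G) : bool :=
  [forall e : edge G,
     (\sum_(a | src a == e) c a == \sum_(a | tgt a == e) c a)%N].

(* The value of a cohomology class on a cycle, computed on a representative of
   the class; see [lambda_class] below for the independence of this choice. *)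
Definition lambda (G : planar_graph) (omega : H1 G) (c : angular_chain G)
    : int :=
  \sum_(a : angle G) (c a)%:Z * (generic_quotient.repr omega : cochain1 G) a.

Lemma delta_cycle (G : planar_graph) (eps : cochain0 G) (c : angular_chain G) :
  angular_cycle c -> \sum_(a : angle G) (c a)%:Z * delta eps a = 0.
Proof.
move=> /forallP cyc.
under eq_bigr do rewrite ffunE mulrBr.
rewrite sumrB (partition_big (@tgt G) xpredT) //=.
rewrite [X in _ - X](partition_big (@src G) xpredT) //= -sumrB.
apply: big1 => e _; apply/eqP; rewrite subr_eq0; apply/eqP.
under eq_bigr => a /eqP -> do [].
under [RHS]eq_bigr => a /eqP -> do [].
rewrite -!mulr_suml; congr (_ * _).
by rewrite -!(big_morph Posz PoszD (erefl _)) (eqP (cyc e)).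
Qed.

Lemma lambda_class (G : planar_graph) (w : cochain1 G) (c : angular_chain G) :
  angular_cycle c ->
  lambda (cohomology_class w) c = \sum_(a : angle G) (c a)%:Z * w a.
Proof.
move=> cyc; apply/eqP; rewrite -subr_eq0 -sumrB; apply/eqP.
under eq_bigr do rewrite -mulrBr.
have : cohomology_class w = cohomology_class (generic_quotient.repr (cohomology_class w)).
  by rewrite /cohomology_class reprK.
move/esym/eqP; rewrite -Quotient.idealrBE => /coboundaryP[eps def_eps].
rewrite -[RHS](delta_cycle eps cyc) -def_eps; apply: eq_bigr => a _.
by rewrite !ffunE.
Qed.

(* The oriented cycle QG(x) formed by the angles of a vertex or face [x]. *)
Definition medial_cycle (G : planar_graph) (x : {set angle G})
    : angular_chain G :=
  [ffun a => (a \in x) : nat].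

Lemma src_flip (G : planar_graph) (h : dart G) :
  edge_of (flip G h) = edge_of h.
Proof.
by apply: val_inj; rewrite /= -[in LHS](expg1 (flip G)) porbit_perm.
Qed.

Lemma mem_porbit_perm (T : finType) (s : {perm T}) (x y : T) :
  (s y \in porbit s x) = (y \in porbit s x).
Proof. by rewrite -!eq_porbit_mem -[in LHS](expg1 s) porbit_perm. Qed.

Lemma medial_cycle_vertex (G : planar_graph) (v : {set angle G}) :
  v \in vertices G -> angular_cycle (medial_cycle v).
Proof.
move=> /imsetP[h _ ->]; apply/forallP=> e; apply/eqP.
rewrite (reindex_inj (@perm_inj _ (cw G))) /=; apply: eq_bigr => a _.
by rewrite !ffunE mem_porbit_perm.
Qed.

Lemma medial_cycle_face (G : planar_graph) (f : {set angle G}) :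
  f \in faces G -> angular_cycle (medial_cycle f).
Proof.
move=> /imsetP[h _ ->]; apply/forallP=> e; apply/eqP.
rewrite (reindex_inj (@perm_inj _ (face_next G))) /=.
apply: eq_big => [a|a _]; first by rewrite /src /tgt permM src_flip.
by rewrite !ffunE mem_porbit_perm.
Qed.

Definition weight_at (G : planar_graph) (omega : weight G)
    (x : {set angle G}) : int :=
  lambda omega (medial_cycle x).

Definition characteristic_weight (G : planar_graph) (omega : weight G) : Prop :=
  forall x, x \in vertices G :|: faces G ->
    weight_at omega x = 0 \/ weight_at omega x = 1.

Definition nilpotency_degree (G : planar_graph) (omega : weight G) (n : int)
    : Prop :=
  (exists c : angular_chain G,
     [/\ angular_cycle c, c != [ffun=> 0%N] & lambda omega c = n]) /\
  (forall c : angular_chain G,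
     angular_cycle c -> c != [ffun=> 0%N] -> n <= lambda omega c).

Definition belongs (G : planar_graph) (e : edge G) (c : angular_chain G)
    : bool :=
  [exists a, (c a != 0)%N && ((src a == e) || (tgt a == e))].

Definition support_adj (G : planar_graph) (c : angular_chain G)
    : rel (edge G) :=
  fun e e' =>
    [exists a, (c a != 0)%N &&
       ((src a == e) && (tgt a == e') || (src a == e') && (tgt a == e))].

Definition connected_chain (G : planar_graph) (c : angular_chain G) : bool :=
  [forall e, forall e',
     belongs e c && belongs e' c ==> connect (support_adj c) e e'].

Definition invisible (G : planar_graph) (omega : weight G)
    (c : angular_chain G) : bool :=
  [&& angular_cycle c, c != [ffun=> 0%N] & lambda omega c == 0].

Definition inv_cycle (G : planar_graph) (omega : weight G) :=
  {c : angular_chain G | invisible omega c && connected_chain c}.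

Definition inv_adj (G : planar_graph) (omega : weight G)
    : rel (inv_cycle omega) :=
  fun c c' => [exists e, belongs e (val c) && belongs e (val c')].

Definition inv_graph_connected (G : planar_graph) (omega : weight G) : Prop :=
  forall c c' : inv_cycle omega,
    exists p : seq (inv_cycle omega),
      path (@inv_adj G omega) c p /\ last c p = c'.

Definition compatible_fun (G : planar_graph) (omega : weight G) :=
  {g : {ffun angle G -> nat} | compatible omega g}.

Definition chi (G : planar_graph) (e : edge G) : cochain0 G :=
  [ffun e' => (e' == e)%:Z].

Definition movable (G : planar_graph) (e : edge G)
    (g : {ffun angle G -> nat}) : bool :=
  [forall a, 0 <= (g a)%:Z + delta (chi e) a].

Definition move_rel (G : planar_graph) (omega : weight G)
    : rel (compatible_fun omega) :=
  fun g g' =>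
    [exists e, movable e (val g) &&
       [forall a, (val g' a)%:Z == (val g a)%:Z + delta (chi e) a]].

Definition compatible_le (G : planar_graph) (omega : weight G)
    (g g' : compatible_fun omega) : Prop :=
  exists p : seq (compatible_fun omega),
    path (@move_rel G omega) g p /\ last g p = g'.

Record bms_state (G : planar_graph) (omega : weight G) := BmsState {
  bms_plus : compatible_fun omega;
  bms_minus : compatible_fun omega;
  bms_dim : {ffun edge G -> nat};
  bms_delta : forall a,
    (val bms_plus a)%:Z =
    (val bms_minus a)%:Z + delta [ffun e => (bms_dim e)%:Z] a;
  bms_inv : forall (c : inv_cycle omega) (e : edge G),
    belongs e (val c) -> bms_dim e = 0%N
}.

Record medial_rep (F : fieldType) (G : planar_graph) := MedialRep {
  rep_dim : edge G -> nat;
  rep_map : forall a : angle G, 'M[F]_(rep_dim (tgt a), rep_dim (src a))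
}.

(* Matrices act on column vectors. *)
Record subrep (F : fieldType) (G : planar_graph) (M : medial_rep F G) :=
  SubRep {
    subrep_space : forall e : edge G, {vspace 'cV[F]_(rep_dim M e)};
    subrep_stable : forall (a : angle G) (v : 'cV[F]_(rep_dim M (src a))),
      v \in subrep_space (src a) ->
      rep_map M a *m v \in subrep_space (tgt a)
  }.

Definition subrep_le (F : fieldType) (G : planar_graph) (M : medial_rep F G)
    (U V : subrep M) : Prop :=
  forall e : edge G, (subrep_space U e <= subrep_space V e)%VS.

Lemma conform_mx_cast (T : Type) m n m' n' (em : m = m') (en : n = n')
    (A : 'M[T]_(m', n')) (B : 'M[T]_(m, n)) :
  conform_mx A B = castmx (em, en) B.
Proof. by case: _ / em A => A; case: _ / en A => A; exact: conform_mx_id. Qed.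

Section BmsRep.
Variables (F : fieldType) (G : planar_graph) (omega : weight G).
Variable xi : bms_state omega.

Local Notation fm := (sval (bms_minus xi)).
Local Notation fp := (sval (bms_plus xi)).
Local Notation d := (bms_dim xi).

(* When the condition of the [if] holds, the block matrix has the dimensions
   of the result and [conform_mx] merely transports it along these equalities;
   see [bms_rep_mapE]. *)
Definition bms_rep_map (a : angle G) : 'M[F]_(d (tgt a), d (src a)) :=
  if (fm a <= d (src a))%N && (fp a <= d (tgt a))%N then
    let r := (d (src a) - fm a)%N in
    conform_mx 0
      (block_mx (0 : 'M_(r, fm a))    (1%:M : 'M_r)
                (0 : 'M_(fp a, fm a)) (0 : 'M_(fp a, r)))
  else 0.

Lemma bms_rep_mapE (a : angle G) i j :
  (fm a <= d (src a))%N -> (fp a <= d (tgt a))%N ->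
  bms_rep_map a i j = (j == fm a + i :> nat)%:R.
Proof.
move=> le_m le_p; rewrite /bms_rep_map le_m le_p /=.
have def_p : (fp a + d (src a) = fm a + d (tgt a))%N.
  have := bms_delta xi a; rewrite !ffunE => def_p.
  by apply/eqP; rewrite -eqz_nat !PoszD def_p -addrA subrK.
have er : (d (src a) - fm a + fp a = d (tgt a))%N by lia.
have ec : (fm a + (d (src a) - fm a) = d (src a))%N by lia.
set B := block_mx _ _ _ _.
rewrite (conform_mx_cast er ec).
rewrite castmxE /B; set i' := cast_ord _ i; set j' := cast_ord _ j.
have -> : (i : nat) = i' by []. have -> : (j : nat) = j' by [].
rewrite -(splitK i') -(splitK j').
case: (split i') => i1; case: (split j') => j1 /=.
- by rewrite block_mxEul mxE; move: (ltn_ord j1); case: eqP => //= -> ?; lia.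
- by rewrite block_mxEur mxE eqn_add2l -val_eqE eq_sym.
- by rewrite block_mxEdl mxE; move: (ltn_ord j1); case: eqP => //= -> ?; lia.
- rewrite block_mxEdr mxE; case: eqP => //= /addnI def_j.
  by have := ltn_ord j1; rewrite def_j ltnNge leq_addr.
Qed.

Definition bms_rep : medial_rep F G := MedialRep bms_rep_map.

End BmsRep.

Section Lattices.
Variables (T : Type) (le : T -> T -> Prop).

Definition is_minimum (x : T) : Prop := forall y, le x y.
Definition is_maximum (x : T) : Prop := forall y, le y x.

Definition is_meet (x y m : T) : Prop :=
  [/\ le m x, le m y & forall z, le z x -> le z y -> le z m].
Definition is_join (x y j : T) : Prop :=
  [/\ le x j, le y j & forall z, le x z -> le y z -> le j z].

Definition is_lattice : Prop :=
  [/\ (forall x, le x x),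
      (forall x y, le x y -> le y x -> x = y),
      (forall x y z, le x y -> le y z -> le x z) &
      forall x y, (exists m, is_meet x y m) /\ (exists j, is_join x y j)].
End Lattices.

(* [leT] and [leU] are the order relations of two lattices, and there is a
   bijection preserving binary meets and joins. *)
Definition lattice_isomorphic (T U : Type)
    (leT : T -> T -> Prop) (leU : U -> U -> Prop) : Prop :=
  [/\ is_lattice leT, is_lattice leU &
      exists phi : T -> U,
        [/\ bijective phi,
            (forall x y m, is_meet leT x y m ->
               is_meet leU (phi x) (phi y) (phi m)) &
            (forall x y j, is_join leT x y j ->
               is_join leU (phi x) (phi y) (phi j))]].

(* Main.v *)
(* Because [inv_graph_connected] holds, two compatible functions differ by
   [delta eps] for a unique [eps] vanishing on the edges of invisible cycles.
   If [eps >= 0] and [eps <> 0], some edge where [eps] is maximal is movable: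
   otherwise each edge of this maximal locus has an outgoing arrow of value 0
   that stays in the locus, and following these arrows gives an invisible cycle
   on which [eps] is positive.  Hence the order on compatible functions is
   [eps >= 0], and meets and joins are minima and maxima of potentials.

   In the standard bases every arrow [a] of the representation acts as the shift
   of coordinates by [f_minus a].  The arrows around a vertex of weight 1
   compose to the nilpotent shift by 1, so each component of a subrepresentation
   is a member of the standard flag.  Its dimension vector [k] satisfies
   [f_minus + delta k >= 0] with [0 <= k <= d_max], i.e. it is the potential of
   a unique compatible function. *)

Require Import Defs.
From mathcomp Require Import all_boot all_order all_algebra all_fingroup.
From mathcomp Require Import zify boolp.
From mathcomp Require Import reals.
From mathcomp.real_closed Require Import complex.

Set Implicit Arguments.
Unset Strict Implicit.
Unset Printing Implicit Defensive.

Import Order.TTheory GRing.Theory Num.Theory.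
Local Open Scope ring_scope.

Lemma sum_eq_pred (T : finType) (P : pred T) (x : T) :
  (\sum_(y | P y) (y == x) = P x)%N.
Proof.
case Px: (P x); last by apply: big1 => y Py; case: eqP Py => // ->; rewrite Px.
by rewrite (bigD1 x) //= eqxx big1 // => y /andP[_ /negPf ->].
Qed.

Lemma sum_neq0 (T : finType) (P : pred T) (F : T -> nat) :
  (\sum_(x | P x) F x != 0)%N -> exists2 x, P x & F x != 0%N.
Proof.
move=> sum_F; apply: contrapT => all0; case/eqP: sum_F; apply: big1 => x Px.
by apply/eqP/negPn/negP=> Fx; apply: all0; exists x.
Qed.

(** * Potentials, invisible cycles and the order on compatible functions *)

Section Potentials.
Variables (G : planar_graph) (omega : weight G).
Implicit Types (g h : compatible_fun omega) (e : edge G) (eps : cochain0 G).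

(* [ffunE] leaves values whose type is not syntactically [int], on which [lia]
   fails. *)
Lemma int_ffunE :
  (((forall (x y : cochain0 G) e, ((x + y) e = x e + y e)%R) *
    (forall (x : cochain0 G) e, ((- x) e = - x e)%R) *
    (forall e, (0%R : cochain0 G) e = 0%R)) *
   (forall (x y : cochain1 G) a, ((x - y) a = x a - y a)%R))%type.
Proof. by do ?split=> *; rewrite !ffunE. Qed.

Lemma deltaE eps a : delta eps a = eps (tgt a) - eps (src a).
Proof. by rewrite ffunE. Qed.

Lemma chiE e e' : chi e e' = (e' == e)%:Z.
Proof. by rewrite ffunE. Qed.

(** [cw a] differs from [a] because degrees are at least 2, and from [flip G a] because there are no
    loops. *)
Lemma tgt_neq_src (a : angle G) : tgt a != src a.
Proof.
apply/eqP=> /(congr1 val) /= /eqP; rewrite eq_porbit_mem => in_orb.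
have := loopless a; rewrite (_ : flip G a \in _) //.
have /porbitP[i def_cw] := in_orb.
have : cw G a = a \/ cw G a = flip G a.
  have flip2 : (flip G ^+ 2 = 1)%g.
    by apply/permP=> x; rewrite expgS expg1 permM flipK perm1.
  rewrite def_cw (divn_eq i 2) mulnC expgD expgM flip2 expg1n mul1g modn2.
  by case: (odd i); [right; rewrite expg1 | left; rewrite expg0 perm1].
case=> [cw_a|<-]; last by rewrite -{1}(expg1 (cw G)) mem_porbit.
have : (#|porbit (cw G) a| <= #|[set a]|)%N.
  apply/subset_leq_card/subsetP=> y /porbitP[k ->].
  by rewrite inE permX iter_fix.
by rewrite cards1 leqNgt degree_ge2.
Qed.

Lemma compatible_class g :
  weight_class omega = cohomology_class [ffun a => (val g a)%:Z].
Proof. by apply/esym/eqP; exact: valP g. Qed.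

Lemma compatible_shift g (h : {ffun angle G -> nat}) eps :
  (forall a, (h a)%:Z = (val g a)%:Z + delta eps a) -> compatible omega h.
Proof.
move=> def_h; rewrite /compatible (compatible_class g) eq_sym.
rewrite -Quotient.idealrBE; apply/coboundaryP; exists (- eps).
by apply/ffunP=> a; rewrite deltaE !int_ffunE !ffunE def_h deltaE; lia.
Qed.

Lemma compatible_diff g h :
  exists eps, forall a, (val h a)%:Z = (val g a)%:Z + delta eps a.
Proof.
have /eqP := etrans (esym (compatible_class h)) (compatible_class g).
rewrite -Quotient.idealrBE => /coboundaryP[eps /ffunP def_eps].
by exists eps => a; rewrite -def_eps !ffunE addrC subrK.
Qed.

Lemma lambda_compatible g (c : angular_chain G) : angular_cycle c ->
  lambda omega c = (\sum_a c a * val g a)%N.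
Proof.
move=> cyc; transitivity (lambda (cohomology_class [ffun a => (val g a)%:Z]) c).
  by congr lambda; exact: compatible_class.
rewrite lambda_class //.
rewrite (big_morph Posz PoszD (erefl _)).
by apply: eq_bigr => a _; rewrite ffunE PoszM.
Qed.

(** [lambda] is a sum of the nonnegative terms [c a * g a], so it vanishes only termwise. *)
Lemma invisible_zero g (c : angular_chain G) a :
  angular_cycle c -> lambda omega c = 0 -> c a != 0%N -> val g a = 0%N.
Proof.
move=> cyc; rewrite (lambda_compatible g cyc) => -[/eqP].
rewrite sum_nat_eq0 => /forallP/(_ a) /=.
by rewrite muln_eq0 => /orP[->|/eqP].
Qed.

Lemma support_adj_sym (c : angular_chain G) : connect_sym (support_adj c).
Proof.
apply: sym_connect_sym => e e'; apply: eq_existsb => b.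
by case: (src b == e) (src b == e') (tgt b == e) (tgt b == e') => [] [] [] [].
Qed.

(** The cycle counts how often the walk uses each angle: it is balanced because the walk closes up,
    invisible because [g] vanishes along it, and connected because its support is a single walk. *)
Lemma closed_walk_inv_cycle g (a : nat -> angle G) p :
  (0 < p)%N -> (forall i, tgt (a i) = src (a i.+1)) -> a p = a 0%N ->
  (forall i, val g (a i) = 0%N) ->
  exists c : inv_cycle omega,
    forall i, (i < p)%N -> belongs (src (a i)) (val c).
Proof.
move=> p_gt0 walk a_p g0.
pose c : angular_chain G := [ffun b => (\sum_(i < p) (b == a i))%N].
have c_a i : (i < p)%N -> c (a i) != 0%N.
  move=> lt_ip; rewrite ffunE (bigD1 (Ordinal lt_ip)) //= eqxx; lia.
have c_supp b : c b != 0%N -> exists2 i, (i < p)%N & b = a i.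
  by rewrite ffunE => /sum_neq0[i _]; rewrite eqb0 negbK => /eqP ->; exists i.
have cyc : angular_cycle c.
  apply/forallP=> e; apply/eqP.
  have sum_c (f : angle G -> edge G) :
      (\sum_(b | f b == e) c b = \sum_(i < p) (f (a i) == e))%N.
    under eq_bigr do rewrite ffunE.
    by rewrite exchange_big; apply: eq_bigr => i _; rewrite sum_eq_pred.
  rewrite !sum_c; under [RHS]eq_bigr do rewrite walk.
  pose F i : nat := src (a i) == e.
  have : (\sum_(i < p) F i + F p = F 0%N + \sum_(i < p) F i.+1)%N.
    transitivity (\sum_(i < p.+1) F i)%N; first by rewrite big_ord_recr.
    by rewrite big_ord_recl.
  by rewrite /F a_p addnC => /addnI.
have inv_c : invisible omega c.
  apply/and3P; split=> //.
    by apply/eqP=> c0; have := c_a _ p_gt0; rewrite c0 ffunE.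
  rewrite (lambda_compatible g cyc) eqz_nat; apply/eqP; apply: big1 => b _.
  have [/c_supp[i _ ->]|/negbNE/eqP ->] := boolP (c b != 0%N) => //.
  by rewrite g0 muln0.
have conn i : (i <= p)%N -> connect (support_adj c) (src (a 0%N)) (src (a i)).
  elim: i => [|i IHi] lt_ip; first exact: connect0.
  apply: connect_trans (IHi (ltnW lt_ip)) (connect1 _); apply/existsP.
  by exists (a i); rewrite c_a //= walk !eqxx.
have conn_b e : belongs e c -> connect (support_adj c) (src (a 0%N)) e.
  case/existsP=> b /andP[/c_supp[i lt_ip ->]] /orP[] /eqP <-.
    exact/conn/ltnW.
  by rewrite walk; exact: conn.
have conn_c : connected_chain c.
  apply/forallP=> e; apply/forallP=> e'; apply/implyP=> /andP[be be'].
  by apply: connect_trans (conn_b _ be'); rewrite support_adj_sym;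
     exact: conn_b.
exists (exist _ c (introT andP (conj inv_c conn_c))) => i lt_ip.
by apply/existsP; exists (a i); rewrite c_a //= eqxx.
Qed.

(** Choosing at each edge of [S] an arrow of value 0 that stays in [S] gives a self-map of a finite
    set; a repetition among its iterates closes up a walk. *)
Lemma zero_trap_inv_cycle g (S : {pred edge G}) e0 :
  e0 \in S ->
  (forall e, e \in S ->
     exists2 a, src a = e & (val g a = 0%N) /\ tgt a \in S) ->
  exists c : inv_cycle omega, exists2 e, e \in S & belongs e (val c).
Proof.
move=> Se0 trap.
(* Outside [S] the angle found at [e0] serves as a default, which makes [nx] total. *)
have exn e : exists a, e \in S -> [/\ src a = e, val g a = 0%N & tgt a \in S].
  case Se: (e \in S).
    by have [a ? []] := trap e Se; exists a.
  by have [a _ _] := trap e0 Se0; exists a.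
have [nx nxP] := choice exn; pose f e := tgt (nx e).
have fS i e : e \in S -> iter i f e \in S.
  by move=> Se; elim: i => //= i /nxP[].
have [x Sx [p p_gt0 fp]] :
    exists2 x, x \in S & exists2 p, (0 < p)%N & iter p f x = x.
  pose F (i : 'I_#|edge G|.+1) := iter i f e0.
  have : ~~ injectiveb F.
    apply/injectiveP=> /leq_card; by rewrite card_ord ltnn.
  case/injectivePn=> i [j neq_ij eqF].
  wlog lt_ij : i j neq_ij eqF / (i < j)%N.
    move=> W; have : (i < j)%N || (j < i)%N by rewrite -neq_ltn.
    by case/orP; [exact: W | apply: W; rewrite 1?eq_sym].
  exists (F i); first exact: fS.
  exists (j - i)%N; first by rewrite subn_gt0.
  by rewrite -iterD subnK // ltnW.
have [] := @closed_walk_inv_cycle g (fun i => nx (iter i f x)) p => //.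
- by move=> i /=; have [->] := nxP _ (fS i.+1 x Sx).
- by rewrite fp.
- by move=> i; have [] := nxP _ (fS i x Sx).
have [src_x _ _] := nxP _ Sx.
by move=> c /(_ 0%N p_gt0); rewrite /= src_x => bc; exists c, x.
Qed.

(** Any two half-edges are joined by steps of [cw], each crossing an angle where [delta eps]
    vanishes, and of [flip], which stay on one edge. *)
Lemma delta_const eps e0 : (forall a, delta eps a = 0) ->
  forall e, eps e = eps e0.
Proof.
move=> d0.
have edgeP e : exists k : dart G, e = edge_of k.
  by have /imsetP[k _ def_e] := valP e; exists k; exact: val_inj.
have [k0 ->] := edgeP e0; move=> e; have [k ->] := edgeP e.
have /connectP[p + ->] := graph_connected k0 k.
elim/last_ind: p => //= p k1 IHp; rewrite rcons_path last_rcons.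
case/andP=> /IHp <- /orP[/eqP ->|/eqP ->]; last by rewrite src_flip.
by have := d0 (last k0 p); rewrite ffunE => /eqP; rewrite subr_eq0 => /eqP.
Qed.

(** The first condition fixes [eps] up to an additive constant; the second fixes the constant once
    an invisible cycle exists. It is the condition on [d] in a BMS state, with signs allowed. *)
Definition normalized_potential g h eps : Prop :=
  (forall a, (val h a)%:Z = (val g a)%:Z + delta eps a) /\
  (forall (c : inv_cycle omega) e, belongs e (val c) -> eps e = 0).

(** Both [g] and [h] vanish on the support of [c], so [eps] agrees at the two ends of each of its
    arrows, and the support is connected. *)
Lemma inv_cycle_const g h eps (c : inv_cycle omega) e e' :
  (forall a, (val h a)%:Z = (val g a)%:Z + delta eps a) ->
  belongs e (val c) -> belongs e' (val c) -> eps e = eps e'.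
Proof.
move=> def_h be be'; have /andP[/and3P[cyc _ /eqP l0] conn] := valP c.
have /connectP[p + ->] : connect (support_adj (val c)) e e'.
  by have /forallP/(_ e)/forallP/(_ e')/implyP := conn; apply; rewrite be.
elim/last_ind: p => //= p k1 IHp; rewrite rcons_path last_rcons.
case/andP=> /IHp -> /existsP[b /andP[cb adj]].
have := def_h b; rewrite !(invisible_zero _ cyc l0 cb) deltaE.
rewrite add0r => /esym/eqP; rewrite subr_eq0 => /eqP eq_b.
by case/orP: adj => /andP[/eqP <- /eqP <-]; rewrite eq_b.
Qed.

Hypothesis nilp0 : nilpotency_degree omega 0.
Hypothesis inv_conn : inv_graph_connected omega.

(** The invisible cycle given by nilpotency degree zero may be disconnected; following its arrows
    extracts a connected one. *)
Lemma inv_cycle_exists : exists (c : inv_cycle omega) e, belongs e (val c).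
Proof.
have [g0 g0P] := weight_compatible omega.
pose g : compatible_fun omega := exist _ g0 g0P.
have [[c [cyc c_neq0 l0]] _] := nilp0.
(* The sources of arrows of [c] form a trap: [g] is 0 on these arrows, and balance at [tgt a] yields
   a next one. *)
pose S := [pred e : edge G | [exists a, (c a != 0%N) && (src a == e)]].
have [a0 ca0] : exists a, c a != 0%N.
  apply/existsP; apply: contraR c_neq0; rewrite negb_exists => /forallP c0.
  by apply/eqP/ffunP=> a; rewrite ffunE; apply/eqP/negbNE/c0.
have [||d [e _ be]] := @zero_trap_inv_cycle g S (src a0).
- by apply/existsP; exists a0; rewrite ca0 eqxx.
- move=> e /existsP[a /andP[ca /eqP src_a]]; exists a => //; split.
    exact: invisible_zero cyc l0 ca.
  have /eqP := forallP cyc (tgt a); rewrite [X in _ = X](bigD1 a) //= => sum_c.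
  have /sum_neq0[b src_b cb] : (\sum_(b | src b == tgt a) c b != 0)%N.
    by rewrite sum_c; move: ca; lia.
  by apply/existsP; exists b; rewrite cb.
by exists d, e.
Qed.

(** Subtracting the value at an edge of one invisible cycle suffices: a potential is constant on
    each such cycle, and a path of cycles passes the constant on through shared edges. *)
Lemma normalized_potential_exists g h :
  exists eps, normalized_potential g h eps.
Proof.
have [eps def_h] := compatible_diff g h.
have [c0 [e0 be0]] := inv_cycle_exists.
exists [ffun e => eps e - eps e0]; split=> [a|c e be].
  by rewrite def_h !ffunE; lia.
rewrite ffunE; apply/eqP; rewrite subr_eq0; apply/eqP.
have [p [+ def_c]] := inv_conn c0 c.
elim/last_ind: p c e be def_c => [|p c1 IHp] c e be /=.
  by move=> def_c _; apply: inv_cycle_const def_h _ be0; rewrite def_c.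
rewrite last_rcons rcons_path => def_c /andP[path_p].
case/existsP=> e1 /andP[be1 be1']; rewrite -(IHp _ _ be1) //.
by rewrite -def_c in be; exact: inv_cycle_const def_h be be1'.
Qed.

Lemma normalized_potential_unique g h eps eps' :
  normalized_potential g h eps -> normalized_potential g h eps' -> eps = eps'.
Proof.
move=> [def_h eps0] [def_h' eps'0].
have [c0 [e0 be0]] := inv_cycle_exists.
apply/ffunP=> e; apply/eqP; rewrite -subr_eq0; apply/eqP.
have := @delta_const (eps - eps') e0 _ e.
rewrite !int_ffunE (eps0 _ _ be0) (eps'0 _ _ be0) => -> // a.
by have := def_h a; rewrite def_h' !deltaE !int_ffunE; lia.
Qed.

Lemma normalized_potential0 g : normalized_potential g g 0.
Proof. by split=> [a|c e _]; rewrite !ffunE ?subrr ?addr0. Qed.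

Lemma normalized_potentialD g1 g2 g3 eps eps' :
  normalized_potential g1 g2 eps -> normalized_potential g2 g3 eps' ->
  normalized_potential g1 g3 (eps + eps').
Proof.
move=> [def2 eps0] [def3 eps'0]; split=> [a|c e be].
  by rewrite def3 def2 !deltaE !int_ffunE; lia.
by rewrite int_ffunE (eps0 _ _ be) (eps'0 _ _ be).
Qed.

Lemma normalized_potentialN g h eps :
  normalized_potential g h eps -> normalized_potential h g (- eps).
Proof.
move=> [def_h eps0]; split=> [a|c e be].
  by rewrite def_h !deltaE !int_ffunE; lia.
by rewrite int_ffunE (eps0 _ _ be).
Qed.

Lemma normalized_potential_shift g eps :
  (forall a, 0 <= (val g a)%:Z + delta eps a) ->
  (forall (c : inv_cycle omega) e, belongs e (val c) -> eps e = 0) ->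
  exists h, normalized_potential g h eps.
Proof.
move=> ge0 eps0; pose h := [ffun a => absz ((val g a)%:Z + delta eps a)].
have def_h a : (h a)%:Z = (val g a)%:Z + delta eps a.
  by rewrite [h a]ffunE gez0_abs.
by exists (exist _ h (compatible_shift def_h)).
Qed.

(** An edge of an invisible cycle is never movable: by balance an arrow of the cycle leaves it, [g]
    is 0 there, and the move would make that value -1. *)
Lemma move_normalized_potential g h :
  move_rel g h -> exists e, normalized_potential g h (chi e).
Proof.
case/existsP=> e /andP[/forallP mov /forallP def_h]; exists e.
split=> [a|c e' be']; first exact/eqP.
rewrite ffunE; case: eqP => // def_e; rewrite -{}def_e in mov *.
have /andP[/and3P[cyc _ /eqP l0] _] := valP c.
have [a ca src_a] : exists2 a, val c a != 0%N & src a = e'.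
  have /existsP[b /andP[cb /orP[/eqP|/eqP] def_e]] := be'; first by exists b.
  have /eqP := forallP cyc e'; rewrite [RHS](bigD1 b) ?def_e //= => sum_c.
  have /sum_neq0[a /eqP] : (\sum_(a | src a == e') val c a != 0)%N.
    by rewrite sum_c addn_eq0 negb_and cb.
  by exists a.
have := mov a; rewrite (invisible_zero g cyc l0 ca) !ffunE -src_a eqxx.
by rewrite (negPf (tgt_neq_src a)).
Qed.

Lemma movable_max_edge g h eps e0 :
  normalized_potential g h eps -> eps e0 != 0 -> (forall e, 0 <= eps e) ->
  exists2 e, movable e (val g) & 0 < eps e.
Proof.
move=> [def_h eps0] e0_neq0 eps_ge0.
pose emax := [arg max_(e > e0) eps e]%O.
have emaxP e : eps e <= eps emax.
  by rewrite /emax; case: Order.TotalTheory.arg_maxP => // i _; apply.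
have emax_gt0 : 0 < eps emax.
  by apply: lt_le_trans (emaxP e0); rewrite lt0r e0_neq0 eps_ge0.
pose S := [pred e | eps e == eps emax].
apply: contrapT => no_mov.
have [|e|c [e /eqP Se be]] := @zero_trap_inv_cycle g S emax.
- exact: eqxx.
- move=> /eqP Se; have : ~~ movable e (val g).
    by apply/negP=> mov; apply: no_mov; exists e; rewrite ?Se.
  rewrite negb_forall => /existsP[a] /=.
  rewrite deltaE !chiE => lt0.
  (* Only an arrow leaving [e] with value 0 can become negative; nonnegativity of [h] then keeps
     [eps] maximal at its target. *)
  have src_a : src a = e.
    apply/eqP; apply: contraNT lt0 => /negPf ->.
    by case: (tgt a == e) => /=; lia.
  have ga : val g a = 0%N.
    by move: lt0; rewrite src_a eqxx; case: (tgt a == e) => /=; lia.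
  exists a => //; split=> //; rewrite inE eq_le emaxP -Se -src_a /=.
  by rewrite -subr_ge0; have := def_h a; rewrite deltaE ga add0r => <-.
by rewrite (eps0 _ _ be) in Se; rewrite -Se ltxx in emax_gt0.
Qed.

(** Each move adds some [chi e]. Conversely, moving at a movable edge where [eps] is positive lowers
    the total of [eps] by 1, which drives the induction. *)
Lemma compatible_leP g h eps : normalized_potential g h eps ->
  compatible_le g h <-> (forall e, 0 <= eps e).
Proof.
move=> pot; split.
  case=> p; elim: p g eps pot => [|g1 p IHp] g eps pot /=.
    case=> _ def_h e; rewrite -def_h in pot.
    rewrite (normalized_potential_unique pot (normalized_potential0 g)).
    by rewrite ffunE.
  case=> /andP[/move_normalized_potential[e1 pot1] path_p] def_h e.
  have pot' := normalized_potentialD (normalized_potentialN pot1) pot.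
  have := IHp _ _ pot' (conj path_p def_h) e; rewrite !int_ffunE chiE.
  by case: (e == e1) => /=; lia.
move=> eps_ge0; have [n] := ubnP (\sum_e `|eps e|%N).
elim: n => // n IHn in g eps pot eps_ge0 *; rewrite ltnS => le_n.
have [eps0|[e0 e0_neq0]] : eps = 0 \/ exists e, eps e != 0.
- have [/existsP|] := boolP [exists e, eps e != 0]; first by right.
  rewrite negb_exists => /forallP eps0; left; apply/ffunP=> e.
  by rewrite ffunE; apply/eqP/negbNE/eps0.
- exists [::]; split=> //=; apply/val_inj/ffunP=> a; apply/eqP.
  by rewrite -eqz_nat pot.1 eps0 !ffunE subrr addr0.
have [e /forallP mov e_gt0] := movable_max_edge pot e0_neq0 eps_ge0.
have [c e' be'|g1 pot1] := @normalized_potential_shift g (chi e) mov.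
  rewrite ffunE; case: eqP => // def_e.
  by rewrite -def_e (pot.2 _ _ be') in e_gt0.
have pot' := normalized_potentialD (normalized_potentialN pot1) pot.
have eps'E e' : (- chi e + eps) e' = eps e' - (e' == e)%:Z.
  by rewrite !int_ffunE chiE addrC.
have [||p [path_p def_h]] := IHn _ _ pot'.
- move=> e'; rewrite eps'E; case: eqP => [->|_]; last by rewrite subr0.
  by rewrite subr_ge0 -gtz0_ge1.
- apply: leq_trans le_n; rewrite (bigD1 e) //= [X in (_ < X)%N](bigD1 e) //=.
  rewrite eps'E eqxx (eq_bigr (fun e' => `|eps e'|%N)); last first.
    by move=> e' /negPf neq; rewrite eps'E neq subr0.
  rewrite ltn_add2r; case: (eps e) e_gt0 => // m.
  by rewrite ltz_nat => m_gt0; lia.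
exists (g1 :: p); split=> //=; rewrite path_p andbT; apply/existsP; exists e.
by apply/andP; split; apply/forallP=> a; rewrite ?mov // pot1.1.
Qed.
End Potentials.

(** * Order isomorphisms and bounds of finite lattices *)

Section OrderLattices.
Variables (T U : Type) (leT : T -> T -> Prop) (leU : U -> U -> Prop).

(** Meets and joins are defined by the order alone, so the lattice axioms on [U] are transported
    from [T]. *)
Lemma lattice_isomorphic_order (phi : T -> U) :
  is_lattice leT -> bijective phi ->
  (forall x y, leT x y <-> leU (phi x) (phi y)) ->
  lattice_isomorphic leT leU.
Proof.
move=> latT bij_phi phiP; have [psi phiK psiK] := bij_phi.
have meetP x y m : is_meet leT x y m -> is_meet leU (phi x) (phi y) (phi m).
  move=> [/phiP mx /phiP my mP]; split=> // z zx zy.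
  by rewrite -(psiK z); apply/phiP/mP; apply/phiP; rewrite psiK.
have joinP x y j : is_join leT x y j -> is_join leU (phi x) (phi y) (phi j).
  move=> [/phiP xj /phiP yj jP]; split=> // z xz yz.
  by rewrite -(psiK z); apply/phiP/jP; apply/phiP; rewrite psiK.
have [refl anti trans bounds] := latT.
split=> //; last by exists phi.
split=> [x|x y|x y z|x y].
- by rewrite -(psiK x); apply/phiP/refl.
- rewrite -(psiK x) -(psiK y) => /phiP xy /phiP yx.
  by rewrite (anti _ _ xy yx).
- rewrite -(psiK x) -(psiK y) -(psiK z) => /phiP xy /phiP yz.
  exact/phiP/trans/yz.
have [[m /meetP mP] [j /joinP jP]] := bounds (psi x) (psi y).
by rewrite !psiK in mP jP; split; [exists (phi m) | exists (phi j)].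
Qed.

Lemma finite_lattice_bounds (I : finType) (f : I -> T) (x0 : T) :
  is_lattice leT -> (forall x, exists i, f i = x) ->
  (exists m, is_minimum leT m) /\ (exists m, is_maximum leT m).
Proof.
move=> [refl _ trans bounds] f_onto.
have lower (s : seq I) : exists m, forall i, i \in s -> leT m (f i).
  elim: s => [|i s [m mP]]; first by exists x0.
  have [[m' [m'm m'i _]] _] := bounds m (f i).
  exists m' => j; rewrite inE => /predU1P[->|/mP] //; exact: trans.
have upper (s : seq I) : exists m, forall i, i \in s -> leT (f i) m.
  elim: s => [|i s [m mP]]; first by exists x0.
  have [_ [m' [mm' im' _]]] := bounds m (f i).
  exists m' => j; rewrite inE => /predU1P[->|/mP fjm] //; exact: trans mm'.
split.
  have [m mP] := lower (enum I); exists m => x; have [i <-] := f_onto x.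
  by apply: mP; rewrite mem_enum.
have [m mP] := upper (enum I); exists m => x; have [i <-] := f_onto x.
by apply: mP; rewrite mem_enum.
Qed.
End OrderLattices.

(** * The finite lattice of compatible functions *)

Section CompatibleLattice.
Variables (G : planar_graph) (omega : weight G).
Implicit Types (g h : compatible_fun omega) (e : edge G) (eps : cochain0 G).

(** At an angle [a] the shifted value is at least [g a] if the minimum at [tgt a] is 0, and at least
    [h a] if it is [eps (tgt a)]. *)
Lemma normalized_potential_min g h eps : normalized_potential g h eps ->
  exists m, normalized_potential g m [ffun e => Num.min 0 (eps e)].
Proof.
move=> [def_h eps0]; apply: normalized_potential_shift => [a|c e be].
  have := def_h a; rewrite !deltaE !ffunE.
  by case: (leP 0 (eps (tgt a))); case: (leP 0 (eps (src a))); lia.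
by rewrite ffunE (eps0 _ _ be) minxx.
Qed.

Lemma normalized_potential_max g h eps : normalized_potential g h eps ->
  exists m, normalized_potential g m [ffun e => Num.max 0 (eps e)].
Proof.
move=> [def_h eps0]; apply: normalized_potential_shift => [a|c e be].
  have := def_h a; rewrite !deltaE !ffunE.
  by case: (leP 0 (eps (tgt a))); case: (leP 0 (eps (src a))); lia.
by rewrite ffunE (eps0 _ _ be) maxxx.
Qed.

Lemma weight_at_compatible g (x : {set angle G}) :
  x \in vertices G :|: faces G -> weight_at omega x = (\sum_(a in x) val g a)%N.
Proof.
move=> Gx; have cyc : angular_cycle (medial_cycle x).
  by case/setUP: Gx => [/medial_cycle_vertex|/medial_cycle_face].
rewrite /weight_at (lambda_compatible g cyc) [in RHS]big_mkcond /=.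
by congr (Posz _); apply: eq_bigr => a _; rewrite ffunE; case: (a \in x); lia.
Qed.

Hypothesis omega_char : characteristic_weight omega.

Lemma vertex_sum_le1 g (a : angle G) :
  (\sum_(b in porbit (cw G) a) val g b <= 1)%N.
Proof.
have Gx : porbit (cw G) a \in vertices G :|: faces G.
  by rewrite inE imset_f.
have := omega_char Gx; rewrite (weight_at_compatible g Gx).
have Posz_inj : injective Posz by move=> m n [].
by case=> [/(Posz_inj _ 0%N)|/(Posz_inj _ 1%N)] ->.
Qed.

Lemma characteristic_le1 g a : (val g a <= 1)%N.
Proof.
apply: leq_trans (vertex_sum_le1 g a); rewrite (bigD1 a) ?leq_addr //.
by rewrite -{1}(perm1 a) -(expg0 (cw G)) mem_porbit.
Qed.

Lemma compatible_fun_finite :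
  exists f : {ffun angle G -> bool} -> compatible_fun omega,
    forall g, exists b, f b = g.
Proof.
have [g0 g0P] := weight_compatible omega.
(* Boolean functions that are not compatible are sent to the default [g0]. *)
exists (fun b => insubd (exist _ g0 g0P : compatible_fun omega)
                   [ffun a => nat_of_bool (b a)]).
move=> g; exists [ffun a => val g a == 1%N].
rewrite [X in insubd _ X](_ : _ = val g) ?valKd //.
apply/ffunP=> a; rewrite !ffunE.
by case: (val g a) (characteristic_le1 g a) => [|[]].
Qed.

Hypothesis nilp0 : nilpotency_degree omega 0.
Hypothesis inv_conn : inv_graph_connected omega.

Let le_pot g h eps := compatible_leP nilp0 (g := g) (h := h) (eps := eps).

Lemma compatible_lattice : is_lattice (@compatible_le G omega).
Proof.
split=> [g|g h|g1 g2 g3 [p [path_p <-]] [q [path_q <-]]|g h].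
- by exists [::].
- have [eps pot] := normalized_potential_exists nilp0 inv_conn g h.
  move=> /(le_pot pot) eps_ge0 /(le_pot (normalized_potentialN pot)) eps_le0.
  have {}pot : normalized_potential g h 0.
    rewrite (_ : 0 = eps) //; apply/ffunP=> e; rewrite int_ffunE.
    apply/eqP; rewrite eq_le eps_ge0 -oppr_ge0.
    by have := eps_le0 e; rewrite int_ffunE.
  apply/val_inj/ffunP=> a; apply/eqP.
  by rewrite -eqz_nat pot.1 deltaE !int_ffunE subrr addr0.
- by exists (p ++ q); rewrite cat_path path_p path_q last_cat.
(* Relative to [g], the meet and the join have potentials [min 0 eps] and [max 0 eps]; each
   comparison is the sign of a composed potential. *)
have [eps pot] := normalized_potential_exists nilp0 inv_conn g h.
have [m potm] := normalized_potential_min pot.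
have [j potj] := normalized_potential_max pot.
have pot_mh := normalized_potentialD (normalized_potentialN potm) pot.
have pot_hj := normalized_potentialD (normalized_potentialN pot) potj.
split; [exists m | exists j]; split.
- apply/(le_pot (normalized_potentialN potm)) => e.
  by rewrite int_ffunE ffunE; case: leP; lia.
- by apply/(le_pot pot_mh) => e; rewrite !int_ffunE ffunE; case: leP; lia.
- move=> z; have [eta potz] := normalized_potential_exists nilp0 inv_conn z g.
  move=> /(le_pot potz) zg /(le_pot (normalized_potentialD potz pot)) zh.
  apply/(le_pot (normalized_potentialD potz potm)) => e.
  by have := zg e; have := zh e; rewrite !int_ffunE ffunE; case: leP; lia.
- by apply/(le_pot potj) => e; rewrite ffunE; case: leP; lia.
- by apply/(le_pot pot_hj) => e; rewrite !int_ffunE ffunE; case: leP; lia.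
move=> z; have [eta potz] := normalized_potential_exists nilp0 inv_conn g z.
move=> /(le_pot potz) zg.
move=> /(le_pot (normalized_potentialD (normalized_potentialN pot) potz)) zh.
apply/(le_pot (normalized_potentialD (normalized_potentialN potj) potz)) => e.
by have := zg e; have := zh e; rewrite !int_ffunE ffunE; case: leP; lia.
Qed.

Lemma compatible_bounds :
  (exists m, is_minimum (@compatible_le G omega) m) /\
  (exists m, is_maximum (@compatible_le G omega) m).
Proof.
have [g0 g0P] := weight_compatible omega.
have [f f_onto] := compatible_fun_finite.
exact: finite_lattice_bounds (exist _ g0 g0P) compatible_lattice f_onto.
Qed.
End CompatibleLattice.

(** * Standard flags and shift-stable subspaces *)

Section Flags.
Variable F : fieldType.

(** Extending coordinates by 0 beyond [n] lets shifts be written with [nat] indices, free of bounds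
    and dimension casts. *)
Definition coord n (v : 'cV[F]_n) (i : nat) : F :=
  oapp (fun j : 'I_n => v j 0) 0 (insub i).

Lemma coord_ord n (v : 'cV[F]_n) (i : 'I_n) : coord v i = v i 0.
Proof. by rewrite /coord valK. Qed.

Lemma coord_lt n (v : 'cV[F]_n) i (lt_in : (i < n)%N) :
  coord v i = v (Ordinal lt_in) 0.
Proof. exact: (coord_ord v (Ordinal lt_in)). Qed.

Lemma coord_out n (v : 'cV[F]_n) i : (n <= i)%N -> coord v i = 0.
Proof. by move=> le_ni; rewrite /coord insubN // -leqNgt. Qed.

Lemma coordP n (u v : 'cV[F]_n) : (forall i, coord u i = coord v i) -> u = v.
Proof. by move=> eq_uv; apply/colP=> i; rewrite -!coord_ord. Qed.

Lemma coord0 n i : coord (0 : 'cV[F]_n) i = 0.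
Proof.
have [le_ni|lt_in] := leqP n i; first exact: coord_out.
by rewrite (coord_lt _ lt_in) mxE.
Qed.

Lemma coordBZ n (u v : 'cV[F]_n) c i :
  coord (u - c *: v) i = coord u i - c * coord v i.
Proof.
have [le_ni|lt_in] := leqP n i; first by rewrite !coord_out // mulr0 subr0.
by rewrite !(coord_lt _ lt_in) !mxE.
Qed.

Lemma coord_delta n (j : 'I_n) i : coord (delta_mx j 0) i = (i == j)%:R.
Proof.
have [le_ni|lt_in] := leqP n i.
  by rewrite coord_out //; case: eqP => // def_i; have := ltn_ord j; lia.
by rewrite (coord_lt _ lt_in) mxE eqxx andbT.
Qed.

(** The span of the first [k] standard basis vectors, as the kernel of the projection onto the other
    coordinates. *)
Definition flag n k : {vspace 'cV[F]_n} :=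
  lker (linfun (mulmx (\matrix_(i < n, j < n) ((k <= i)%N && (i == j))%:R))).

Lemma memv_flag n k (v : 'cV[F]_n) :
  reflect (forall i, (k <= i)%N -> coord v i = 0) (v \in flag n k).
Proof.
have mulE (i : 'I_n) :
    (\matrix_(i < n, j < n) ((k <= i)%N && (i == j))%:R *m v) i 0
      = if (k <= i)%N then v i 0 else 0.
  rewrite mxE (bigD1 i) //= big1 => [|j /negPf neq_ji].
    by rewrite mxE eqxx andbT addr0; case: ifP; rewrite ?mul1r ?mul0r.
  by rewrite mxE eq_sym neq_ji andbF mul0r.
rewrite memv_ker lfunE; apply: (iffP eqP) => [/colP v0 i le_ki|v0].
  have [le_ni|lt_in] := leqP n i; first exact: coord_out.
  rewrite (coord_lt _ lt_in).
  by have := v0 (Ordinal lt_in); rewrite mulE /= le_ki mxE.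
by apply/colP=> i; rewrite mulE mxE -coord_ord; case: ifP => // /v0.
Qed.

Lemma subv_flag n k k' : (k <= n)%N ->
  (flag n k <= flag n k')%VS = (k <= k')%N.
Proof.
move=> le_kn; apply/subvP/idP=> [sub_kk'|le_kk' v].
  rewrite leqNgt; apply/negP=> lt_k'k.
  have lt_kn : (k.-1 < n)%N by lia.
  have in_k : delta_mx (Ordinal lt_kn) 0 \in flag n k.
    by apply/memv_flag=> i le_ki; rewrite coord_delta /=; case: eqP => //; lia.
  have le_k' : (k' <= k.-1)%N by lia.
  have /memv_flag/(_ _ le_k')/eqP := sub_kk' _ in_k.
  by rewrite coord_delta eqxx oner_eq0.
by move=> /memv_flag v0; apply/memv_flag=> i le_k'i; apply: v0; lia.
Qed.

Lemma shift_stable_flag n (U : {vspace 'cV[F]_n}) :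
  (forall v, v \in U ->
     exists2 v', v' \in U & forall i, coord v' i = coord v i.+1) ->
  exists2 k, (k <= n)%N & U = flag n k.
Proof.
move=> shiftU.
have shiftnU j v : v \in U ->
    exists2 v', v' \in U & forall i, coord v' i = coord v (j + i).
  elim: j => [|j IHj] Uv; first by exists v.
  have [v1 /shiftU[v2 Uv2 def_v2] def_v1] := IHj Uv.
  by exists v2 => // i; rewrite def_v2 def_v1 addnS.
have exk : exists k, (U <= flag n k)%VS.
  by exists n; apply/subvP=> v _; apply/memv_flag=> i; exact: coord_out.
case: (ex_minnP exk) => k subUk k_min; exists k.
  by apply: k_min; apply/subvP=> v _; apply/memv_flag=> i; exact: coord_out.
have top m : (m < k)%N -> exists2 u, u \in U &
    coord u m != 0 /\ forall i, (m < i)%N -> coord u i = 0.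
  (* With the least bound now [k.+1], some vector of [U] is nonzero in coordinate [k]; its shift by
     [k - m] has top coordinate [m]. *)
  case: k subUk k_min => // k subUk k_min lt_mk.
  have : ~~ (U <= flag n k)%VS by apply/negP=> /k_min; rewrite ltnn.
  case/subvPn=> v Uv not_kv; have /memv_flag vk := subvP subUk v Uv.
  have [u Uu def_u] := shiftnU (k - m)%N v Uv; exists u => //.
  split=> [|i lt_mi]; last by rewrite def_u vk //; lia.
  rewrite def_u subnK //; apply: contra not_kv => /eqP vk0.
  by apply/memv_flag=> i; rewrite leq_eqVlt => /predU1P[<-|/vk].
apply/eqP; rewrite eqEsubv subUk /=.
suff : forall m, (m <= k)%N -> (flag n m <= U)%VS by apply.
elim=> [_|m IHm lt_mk]; apply/subvP=> v /memv_flag v0.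
  rewrite (_ : v = 0) ?mem0v //; apply: coordP => i.
  by rewrite v0 // coord0.
have [u Uu [um u0]] := top m lt_mk.
(* Subtracting a multiple of [u] kills coordinate [m] of [v] and leaves a vector of [flag n m]. *)
rewrite -(subrK ((coord v m / coord u m) *: u) v) rpredD ?rpredZ //.
apply: (subvP (IHm (ltnW lt_mk))); apply/memv_flag=> i; rewrite coordBZ.
rewrite leq_eqVlt => /predU1P[<-|lt_mi]; first by rewrite divfK ?subrr.
by rewrite (v0 i) // (u0 i) // mulr0 subr0.
Qed.
End Flags.

(** * Subrepresentations as families of flags *)

Section Subrepresentations.
Variables (F : fieldType) (G : planar_graph) (omega : weight G).
Variable xi : bms_state omega.

Local Notation fm := (sval (bms_minus xi)).
Local Notation fp := (sval (bms_plus xi)).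
Local Notation d := (bms_dim xi).
Local Notation M := (bms_rep F xi).

(** The shift formula also covers the case where the map is set to 0: if [fm a] exceeds [d (src a)],
    every index on the right is out of range. *)
Lemma bms_rep_coord (a : angle G) (v : 'cV[F]_(d (src a))) i :
  coord (bms_rep_map F xi a *m v) i = coord v (fm a + i).
Proof.
have def_p : (fp a + d (src a) = fm a + d (tgt a))%N.
  have := bms_delta xi a; rewrite !ffunE => def_p.
  by apply/eqP; rewrite -eqz_nat !PoszD def_p -addrA subrK.
have [le_di|lt_id] := leqP (d (tgt a)) i; first by rewrite !coord_out //; lia.
rewrite (coord_lt _ lt_id).
have [le_m|lt_m] := leqP (fm a) (d (src a)); last first.
  rewrite coord_out; last by lia.
  by rewrite /bms_rep_map leqNgt lt_m mul0mx mxE.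
have le_p : (fp a <= d (tgt a))%N by lia.
rewrite mxE; under eq_bigr do rewrite bms_rep_mapE //=.
have [le_d|lt_d] := leqP (d (src a)) (fm a + i)%N.
  rewrite coord_out // big1 // => j _.
  case: eqP => [def_j|_]; last by rewrite mul0r.
  by have := ltn_ord j; rewrite def_j ltnNge le_d.
rewrite (coord_lt _ lt_d) (bigD1 (Ordinal lt_d)) //= eqxx mul1r.
rewrite big1 ?addr0 // => j; rewrite -val_eqE /= => /negPf ->.
by rewrite mul0r.
Qed.

(** [kP] says that [fm + delta k] is nonnegative. The definition is transparent so that its spaces
    reduce to flags. *)
Definition flag_subrep (k : edge G -> nat)
    (kP : forall a, (k (src a) <= fm a + k (tgt a))%N) : subrep M.
Proof.
exists (fun e => flag F (d e) (k e)) => a v /memv_flag v0.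
apply/memv_flag=> i le_ki; rewrite bms_rep_coord v0 //.
by apply: leq_trans (kP a) _; rewrite leq_add2l.
Defined.

Lemma subrep_eqP (U V : subrep M) :
  (forall e, subrep_space U e = subrep_space V e) -> U = V.
Proof.
case: U V => [U U_st] [V V_st] /= eqUV.
have {}eqUV : U = V by apply: functional_extensionality_dep.
by case: V / eqUV V_st => V_st; congr SubRep; exact: Prop_irrelevance.
Qed.

Lemma subrep_rotate (U : subrep M) (h : dart G) n (v : 'cV[F]_(d (edge_of h))) :
  v \in subrep_space U (edge_of h) ->
  exists2 v' : 'cV[F]_(d (edge_of (iter n (cw G) h))),
    v' \in subrep_space U (edge_of (iter n (cw G) h)) &
    forall i, coord v' i = coord v (\sum_(j < n) fm (iter j (cw G) h) + i)%N.
Proof.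
move=> Uv; elim: n => [|n [v1 Uv1 def_v1]].
  by exists v => // i; rewrite big_ord0.
exists (bms_rep_map F xi (iter n (cw G) h) *m v1).
  exact: (subrep_stable (s := U)).
move=> i; rewrite bms_rep_coord def_v1 big_ord_recr /=.
by rewrite addnA.
Qed.

(** One turn around a vertex of weight 0 is an invisible cycle through the edge, where [bms_inv]
    makes [d] vanish. *)
Lemma vertex_sum0_dim0 (h : dart G) :
  (\sum_(a in porbit (cw G) h) fm a = 0)%N -> d (edge_of h) = 0%N.
Proof.
move=> sum0.
have fm0 i : fm (iter i (cw G) h) = 0%N.
  apply/eqP; have /eqP := sum0; rewrite sum_nat_eq0 => /forall_inP; apply.
  by rewrite -permX mem_porbit.
have [||||c /(_ 0%N) bc] := @closed_walk_inv_cycle _ _ (bms_minus xi)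
  (fun i => iter i (cw G) h) #|porbit (cw G) h| => //.
- by apply: leq_trans (degree_ge2 h).
- by rewrite iter_porbit.
apply: (@bms_inv _ _ xi c); apply: bc.
by apply: leq_trans (degree_ge2 h).
Qed.

Hypothesis omega_char : characteristic_weight omega.

(* Going once around an end of [e] acts on [U e] as the nilpotent shift, since
   the weight of that vertex is 1 unless [d e = 0]. *)
Lemma subrep_shift (U : subrep M) e (v : 'cV[F]_(d e)) :
  v \in subrep_space U e ->
  exists2 v', v' \in subrep_space U e & forall i, coord v' i = coord v i.+1.
Proof.
have [h def_e] : exists h : dart G, e = edge_of h.
  by have /imsetP[h _ def_e] := valP e; exists h; exact: val_inj.
rewrite {e}def_e in v * => Uv.
have sum_h : (\sum_(j < #|porbit (cw G) h|) fm (iter j (cw G) h) =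
              \sum_(a in porbit (cw G) h) fm a)%N.
  rewrite -(eq_bigl _ _ (fun a => esym (porbit_traject (cw G) h a))).
  rewrite -big_uniq ?uniq_traject_porbit //=.
  rewrite (big_nth h) size_traject big_mkord; apply: eq_bigr => j _.
  by rewrite nth_traject.
have := vertex_sum_le1 omega_char (bms_minus xi) h.
rewrite leq_eqVlt ltnS leqn0.
case/predU1P=> [sum1|/eqP/vertex_sum0_dim0 d0]; last first.
  by exists v => // i; rewrite !coord_out //= d0.
have := subrep_rotate #|porbit (cw G) h| Uv.
(* After a full turn the iterate of [cw] is [h] again, so [v'] lies over the same edge and the total
   shift is 1. *)
rewrite iter_porbit (etrans sum_h sum1) => -[v' Uv' def_v'].
by exists v'.
Qed.

Lemma subrep_flag (U : subrep M) :
  exists k : edge G -> nat,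
    [/\ forall e, (k e <= d e)%N,
        forall e, subrep_space U e = flag F (d e) (k e) &
        forall a, (k (src a) <= fm a + k (tgt a))%N].
Proof.
have exk e : exists k, (k <= d e)%N /\ subrep_space U e = flag F (d e) k.
  by have [k] := shift_stable_flag (@subrep_shift U e); exists k.
have [k kP] := choice exk; exists k.
split=> [e|e|a]; [by case: (kP e) | by case: (kP e) |].
have [[le_s Us] [le_t Ut]] := (kP (src a), kP (tgt a)).
(* Otherwise the last basis vector of the flag at [src a], of index [k (src a) - 1], is sent to the
   one of index [k (src a) - 1 - fm a], outside the flag at [tgt a]. *)
rewrite leqNgt; apply/negP=> lt_k.
have lt_d : ((k (src a)).-1 < d (src a))%N by lia.
have /(subrep_stable (s := U)) :
    delta_mx (Ordinal lt_d) 0 \in subrep_space U (src a).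
  rewrite Us; apply/memv_flag=> i le_ki.
  by rewrite coord_delta /=; case: eqP => //; lia.
have le_i : (k (tgt a) <= (k (src a)).-1 - fm a)%N by lia.
rewrite Ut => /memv_flag/(_ _ le_i)/eqP; rewrite bms_rep_coord coord_delta /=.
rewrite subnKC; last by lia.
by rewrite eqxx oner_eq0.
Qed.
End Subrepresentations.

(** * BMS states as potentials, and the isomorphism *)

Section MaximalState.
Variables (G : planar_graph) (omega : weight G).
Implicit Types (g h : compatible_fun omega) (eps : cochain0 G).
Hypothesis nilp0 : nilpotency_degree omega 0.

Lemma bms_state_unique (xi xi' : bms_state omega) :
  bms_minus xi = bms_minus xi' -> bms_plus xi = bms_plus xi' -> xi = xi'.
Proof.
have potP (x : bms_state omega) :
    normalized_potential (bms_minus x) (bms_plus x)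
      [ffun e => (bms_dim x e)%:Z].
  by split=> [|c e be]; [exact: bms_delta | rewrite ffunE (bms_inv x be)].
move=> eq_m eq_p; have := potP xi; rewrite eq_m eq_p => pot.
have /ffunP eq_d := normalized_potential_unique nilp0 pot (potP xi').
have {eq_d pot} : bms_dim xi = bms_dim xi'.
  by apply/ffunP=> e; have := eq_d e; rewrite !ffunE => -[].
case: xi xi' eq_m eq_p {potP} => [p m d dP d0] [p' m' d' dP' d0'] /=.
move=> eq_m eq_p eq_d.
move: dP d0 dP' d0'; rewrite eq_m eq_p eq_d => dP d0 dP' d0'.
by congr BmsState; exact: Prop_irrelevance.
Qed.

Lemma bms_state_of_le g h eps : normalized_potential g h eps ->
  (forall e, 0 <= eps e) ->
  exists xi : bms_state omega,
    [/\ bms_minus xi = g, bms_plus xi = h &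
        forall e, (bms_dim xi e)%:Z = eps e].
Proof.
move=> [def_h eps0] eps_ge0; pose d := [ffun e => absz (eps e)].
have dE e : (d e)%:Z = eps e by rewrite ffunE gez0_abs.
have d_delta a : (val h a)%:Z = (val g a)%:Z + delta [ffun e => (d e)%:Z] a.
  by rewrite def_h !deltaE ![[ffun e => (d e)%:Z] _]ffunE !dE.
have d_inv (c : inv_cycle omega) e : belongs e (val c) -> d e = 0%N.
  by move=> be; apply/eqP; rewrite -eqz_nat dE (eps0 _ _ be).
by exists (BmsState d_delta d_inv).
Qed.

Variable F : fieldType.
Hypothesis omega_char : characteristic_weight omega.
Hypothesis inv_conn : inv_graph_connected omega.

(** Minimality of [bms_minus xi] makes the potential of each [g] nonnegative, and maximality of
    [bms_plus xi] bounds it by [bms_dim xi], so it can serve as a dimension vector of flags. *)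
Lemma subreps_lattice_isomorphic (xi : bms_state omega) :
  is_minimum (@compatible_le G omega) (bms_minus xi) ->
  is_maximum (@compatible_le G omega) (bms_plus xi) ->
  lattice_isomorphic (@compatible_le G omega) (@subrep_le F G (bms_rep F xi)).
Proof.
set f_m := bms_minus xi; set f_p := bms_plus xi => min_m max_p.
have le_pot g h eps := compatible_leP nilp0 (g := g) (h := h) (eps := eps).
have pot_d : normalized_potential f_m f_p [ffun e => (bms_dim xi e)%:Z].
  by split=> [|c e be]; [exact: bms_delta | rewrite ffunE (bms_inv xi be)].
have [pot potP] := choice (normalized_potential_exists nilp0 inv_conn f_m).
have pot_ge0 g (e : edge G) : 0 <= pot g e.
  exact: (proj1 (le_pot _ _ _ (potP g)) (min_m g) e).
pose k g (e : edge G) := absz (pot g e).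
have kE g (e : edge G) : (k g e)%:Z = pot g e by rewrite gez0_abs.
have kP g (a : angle G) : (k g (src a) <= val f_m a + k g (tgt a))%N.
  rewrite -lez_nat PoszD !kE -subr_ge0 -addrA.
  by have := (potP g).1 a; rewrite deltaE => <-.
have k_le_d g (e : edge G) : (k g e <= bms_dim xi e)%N.
  have pot_gp := normalized_potentialD (normalized_potentialN (potP g)) pot_d.
  have /(le_pot _ _ _ pot_gp)/(_ e) := max_p g.
  by rewrite !int_ffunE ffunE -kE addrC subr_ge0 lez_nat.
pose phi g := flag_subrep F (kP g).
have phiP g h : compatible_le g h <-> subrep_le (phi g) (phi h).
  have pot_gh :=
    normalized_potentialD (normalized_potentialN (potP g)) (potP h).
  rewrite (le_pot _ _ _ pot_gh); split=> le_gh e; have := le_gh e.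
    by rewrite !int_ffunE -!kE addrC subr_ge0 lez_nat subv_flag.
  by rewrite !int_ffunE -!kE addrC subr_ge0 lez_nat /= subv_flag.
have lat := compatible_lattice nilp0 inv_conn.
have phi_onto U : exists g, phi g = U.
  have [k' [k'd k'U k'P]] := subrep_flag omega_char U.
  (* Being bounded by [bms_dim xi], the dimensions of [U] vanish on invisible cycles and so form a
     normalized potential. *)
  pose eps : cochain0 G := [ffun e => (k' e)%:Z].
  have epsE e : eps e = (k' e)%:Z by rewrite ffunE.
  have [a|c e be|g pot_g] := @normalized_potential_shift _ _ f_m eps.
  - rewrite deltaE !epsE addrA subr_ge0 -PoszD lez_nat; exact: k'P.
  - by rewrite epsE; have := k'd e; rewrite (bms_inv xi be) leqn0 => /eqP ->.
  exists g; apply: subrep_eqP => e; rewrite k'U /= /k.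
  by rewrite (normalized_potential_unique nilp0 (potP g) pot_g) epsE.
have [psi psiK] := choice phi_onto.
apply: (lattice_isomorphic_order _ _ phiP) => //; exists psi => // g.
(* Injectivity is antisymmetry: [psi (phi g)] and [g] have the same image. *)
by have [_ anti _ _] := lat; apply: anti; apply/phiP=> e; rewrite psiK.
Qed.
End MaximalState.

(* The complex numbers are [R[i]], for [R] the real numbers. *)
Theorem corollary5p14 (R : realType) (G : planar_graph) (omega : weight G)
  (nilp0 : nilpotency_degree omega 0%Z)
  (omega_char : characteristic_weight omega)
  (inv_conn : inv_graph_connected omega) :
  exists f_minus f_plus : compatible_fun omega,
    is_minimum (@compatible_le G omega) f_minus /\
    is_maximum (@compatible_le G omega) f_plus /\
    exists xi_max : bms_state omega,
      unique
        (fun xi => bms_minus xi = f_minus /\ bms_plus xi = f_plus) xi_max /\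
      lattice_isomorphic (@compatible_le G omega)
        (@subrep_le R[i] G (bms_rep R[i] xi_max)).
Proof.
have [[f_m min_m] [f_p max_p]] := compatible_bounds omega_char nilp0 inv_conn.
exists f_m, f_p; split=> //; split=> //.
have [eps pot] := normalized_potential_exists nilp0 inv_conn f_m f_p.
have /(compatible_leP nilp0 pot) eps_ge0 := min_m f_p.
have [xi [xi_m xi_p _]] := bms_state_of_le pot eps_ge0.
exists xi; split.
  split=> // xi' [xi'_m xi'_p].
  by apply: bms_state_unique; rewrite ?xi_m ?xi_p ?xi'_m ?xi'_p.
by apply: subreps_lattice_isomorphic; rewrite ?xi_m ?xi_p.
Qed.
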